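(* There exist a function $\varphi\in C(\mathbb{T})$ and a singular Borel measure $\mu$ on $\mathbb{T}$ without atomic masses such that the operator $(\cdot,\varphi)1-(\cdot,1)\varphi$ on $L^2(\mu)$ cannot be represented as a commutator $AU-UA$ for any bounded operator $A$ on $L^2(\mu)$, where $U$ is the operator of multiplication by the independent variable on $L^2(\mu)$.
   Context: $\mathbb{T}$ is the unit circle in $\mathbb{C}$ and $C(\mathbb{T})$ is the set of all continuous functions on $\mathbb{T}$. Measures on $\mathbb{T}$ are finite and nonnegative; ''singular'' means singular with respect to Lebesgue measure on $\mathbb{T}$. $(\cdot,\cdot)$ is the inner product of $L^2(\mu)$ (linear in the first argument), and $(\cdot,u)v$ denotes the operator $h\mapsto(h,u)v$. The operator $U$ is given by $(Uf)(z)=zf(z)$. *)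

(* Defs.v *)
From HB Require Import structures.
From mathcomp Require Import all_boot all_order all_algebra ring lra.
From mathcomp Require Import complex.
From mathcomp Require Import all_classical all_reals all_analysis measurable_realfun.
Import Order.TTheory GRing.Theory Num.Theory.
Import numFieldNormedType.Exports.
Set Implicit Arguments. Unset Strict Implicit. Unset Printing Implicit Defensive.
Local Open Scope classical_set_scope.
Local Open Scope ring_scope.
Local Open Scope complex_scope.
Local Notation Re := (@complex.Re _).
Local Notation Im := (@complex.Im _).

(* R[i] carries no topology in the libraries; this is the one of its modulus. *)
HB.instance Definition _ (R : realType) := NormedModule.copy R[i] R[i]^o.

Section complex_continuity.
Context {R : realType}.
Implicit Types z : R[i].

Lemma complex_lt_dist (a : R) (e : R[i]) : 0 < e -> a < Re e -> a%:C < e.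
Proof.
by move=> e0 ae; rewrite ltcE/= ae (ger0_Im (ltW e0)) eqxx.
Qed.

Lemma norm_Re_le z : `|Re z| <= Re `|z|.
Proof. by rewrite -lecR (le_trans (normc_ge_Re z))// normc_def. Qed.

Lemma norm_Im_le z : `|Im z| <= Re `|z|.
Proof.
by rewrite normc_def/= -sqrtr_sqr ler_wsqrtr// lerDr sqr_ge0.
Qed.

Lemma norm_le_ReIm z : Re `|z| <= `|Re z| + `|Im z|.
Proof.
rewrite normc_def/= -[leRHS]ger0_norm ?addr_ge0// -sqrtr_sqr ler_wsqrtr//.
by rewrite sqrrD !real_normK ?num_real// lerD2r lerDl mulrn_wge0// mulr_ge0.
Qed.

Lemma continuous_Re : continuous (@complex.Re R : R[i] -> R).
Proof.
move=> z.
have FF : Filter (nbhs z) by exact: nbhs_filter.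
apply/(@cvgrPdist_lt _ _ _ _ FF) => e e0.
have e0' : 0 < e%:C by rewrite ltcR.
apply: filterS (nbhsx_ballx z _ e0') => w.
rewrite -ball_normE/= normc_def ltcR; apply: le_lt_trans.
by have := norm_Re_le (z - w); rewrite normc_def; case: (z) (w) => [? ?] [? ?].
Qed.

Lemma continuous_Im : continuous (@complex.Im R : R[i] -> R).
Proof.
move=> z.
have FF : Filter (nbhs z) by exact: nbhs_filter.
apply/(@cvgrPdist_lt _ _ _ _ FF) => e e0.
have e0' : 0 < e%:C by rewrite ltcR.
apply: filterS (nbhsx_ballx z _ e0') => w.
rewrite -ball_normE/= normc_def ltcR; apply: le_lt_trans.
by have := norm_Im_le (z - w); rewrite normc_def; case: (z) (w) => [? ?] [? ?].
Qed.

Lemma continuous_complex (T : topologicalType) (f g : T -> R) :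
  continuous f -> continuous g -> continuous (fun x => f x +i* g x).
Proof.
move=> cf cg x; apply/cvgrPdist_lt => e e0.
have e20 : 0 < Re e / 2.
  by move: e0; rewrite ltcE/= => /andP[_ e0]; rewrite divr_gt0.
move: (cf x) (cg x) => /cvgrPdist_lt/(_ _ e20) + /cvgrPdist_lt/(_ _ e20).
apply: filterS2 => y fxy gxy.
have h := norm_le_ReIm ((f x +i* g x) - (f y +i* g y)).
move: h; rewrite normc_def => h; apply: complex_lt_dist => //.
by rewrite (le_lt_trans h)//= [ltRHS]splitr ltrD.
Qed.

End complex_continuity.

Section circle.
Context (R : realType).

Definition unit_circle : set R[i] := [set z | `|z| = 1].

Definition circle : Type := set_type unit_circle.

HB.instance Definition _ := Topological.on circle.

Lemma expi_in_circle (t : R) : (cos t +i* sin t : R[i]) \in unit_circle.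
Proof. by apply/mem_set; rewrite /unit_circle/= normc_def/= cos2Dsin2 sqrtr1. Qed.

Definition circle_expi (t : R) : circle := SigSub (expi_in_circle t).

HB.instance Definition _ := isPointed.Build circle (circle_expi 0).
HB.instance Definition _ :=
  Measurable.copy circle (g_sigma_algebraType (@open circle)).

Definition circle_val (z : circle) : R[i] := val z.

End circle.

Section circle_measure.
Context (R : realType).
Local Notation T := (circle R).

Lemma continuous_circle_val : continuous (@circle_val R).
Proof. exact: initial_continuous. Qed.

Lemma continuous_circle_expi : continuous (@circle_expi R).
Proof.
apply: (@continuous_comp_initial T R R[i]).
by apply: continuous_complex; [exact: continuous_cos|exact: continuous_sin].
Qed.

Lemma measurable_circle_expi :
  measurable_fun [set: measurableTypeR R] (@circle_expi R).
Proof.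
apply: (@measurability _ _ (measurableTypeR R) T _ _ open) => // _ [A oA <-].
rewrite setTI; apply: open_measurable.
by move/continuousP: continuous_circle_expi; exact.
Qed.

Lemma continuous_circle_measurable (f : T -> R) :
  continuous f -> measurable_fun [set: T] f.
Proof.
move=> cf; apply: (@measurability _ _ T (measurableTypeR R) _ _ _
  (@RGenOpens.measurableE R)) => _ [_ [a [b ->]] <-].
rewrite setTI; apply: sub_sigma_algebra.
by move/continuousP: cf; apply; exact: itv_open.
Qed.

Lemma circle_expi_surj (z : T) : exists2 t, t \in `[- pi, pi] & circle_expi t = z.
Proof.
case: z => -[a b] zP.
have : unit_circle (a +i* b) by exact: set_mem.
rewrite /unit_circle/= normc_def/= => -[ab].
have {}ab : a ^+ 2 + b ^+ 2 = 1.
  by rewrite -[LHS]sqr_sqrtr ?addr_ge0 ?sqr_ge0// ab expr1n.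
have a1 : -1 <= a <= 1.
  rewrite -ler_norml -(@ler_pXn2r _ 2)// ?nnegrE// expr1n.
  by rewrite real_normK ?num_real// -ab lerDl sqr_ge0.
have p0 := acos_ge0 a1; have p1 := acos_lepi a1.
have sa : sin (acos a) = `|b| by rewrite sin_acos// -ab addrAC subrr add0r sqrtr_sqr.
have [b0|b0] := leP 0 b.
  exists (acos a).
    by rewrite in_itv/= p1 (le_trans _ p0)// oppr_le0 pi_ge0.
  apply/val_inj => /=; rewrite sa acosK ?in_itv//= ger0_norm//.
exists (- acos a).
  by rewrite in_itv/= lerN2 p1/= (le_trans _ (pi_ge0 R))// oppr_le0.
by apply/val_inj => /=; rewrite cosN sinN sa acosK ?in_itv//= ltr0_norm// opprK.
Qed.

Lemma continuous_circle_bounded (f : T -> R) :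
  continuous f -> exists M, forall z, `|f z| <= M.
Proof.
move=> cf.
have cg : {within `[- pi, pi], continuous (fun t => `|f (circle_expi t)|)}.
  apply: continuous_subspaceT => t.
  apply: (@continuous_comp _ _ _ (f \o @circle_expi R) Num.norm);
    last exact: norm_continuous.
  by apply: continuous_comp; [exact: continuous_circle_expi|exact: cf].
have pp : - pi <= pi :> R by rewrite (@le_trans _ _ 0) ?oppr_le0 ?pi_ge0.
have [c _ cmax] := EVT_max pp cg.
exists `|f (circle_expi c)| => z.
have [t tpi <-] := circle_expi_surj z; exact: cmax.
Qed.

Let segment_measurable : measurable (`[0, 2 * pi[%classic : set (measurableTypeR R)).
Proof. exact: measurable_itv. Qed.

(* Arc length: image of the Lebesgue measure of [0, 2 pi[ under t |-> e^(it). *)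
Definition circle_lebesgue : set T -> \bar R :=
  pushforward (mrestr lebesgue_measure segment_measurable) (@circle_expi R).

Let circle_lebesgue0 : circle_lebesgue set0 = 0%E.
Proof. by rewrite /circle_lebesgue /pushforward preimage_set0 measure0. Qed.

Let circle_lebesgue_ge0 A : (0 <= circle_lebesgue A)%E.
Proof. exact: (measure_ge0 (mrestr lebesgue_measure segment_measurable)). Qed.

Let circle_lebesgue_sigma_additive : semi_sigma_additive circle_lebesgue.
Proof.
move=> F mF tF mUF; rewrite /circle_lebesgue /pushforward preimage_bigcup.
have mE A : measurable A -> measurable (@circle_expi R @^-1` A).
  by move=> mA; rewrite -[X in measurable X]setTI; exact: measurable_circle_expi.
apply: measure_semi_sigma_additive.
- by move=> n; exact: mE.
- apply/trivIsetP => /= i j _ _ ij; rewrite -preimage_setI.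
  by move/trivIsetP : tF => /(_ _ _ _ _ ij) ->//; rewrite preimage_set0.
- by rewrite -preimage_bigcup; exact: mE.
Qed.

HB.instance Definition _ := isMeasure.Build _ _ _ circle_lebesgue
  circle_lebesgue0 circle_lebesgue_ge0 circle_lebesgue_sigma_additive.

End circle_measure.
Arguments circle_lebesgue : clear implicits.

Section L2_space.
Context {d} {T : measurableType d} {R : realType}.
Variable mu : {measure set T -> \bar R}.
Local Notation normc := Normc.normc.

Definition complex_integral (f : T -> R[i]) : R[i] :=
  (\int[mu]_x Re (f x)) +i* (\int[mu]_x Im (f x)).

(* Square-integrable complex functions; Borel measurability of f is that of its
   real and imaginary parts. *)
Definition L2_fun_pred : {pred T -> R[i]} :=
  mem [set f : T -> R[i] | [/\ measurable_fun setT (Re \o f),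
                   measurable_fun setT (Im \o f)
                 & (\int[mu]_x (normc (f x) ^+ 2)%:E < +oo)%E]].

Lemma normc_sqr (z : R[i]) : normc z ^+ 2 = Re z ^+ 2 + Im z ^+ 2.
Proof. by case: z => a b /=; rewrite sqr_sqrtr// addr_ge0 ?sqr_ge0. Qed.

Lemma normc_ge0 (z : R[i]) : 0 <= normc z.
Proof. by case: z => a b; exact: sqrtr_ge0. Qed.

Lemma measurable_normc_sqr (f : T -> R[i]) :
  measurable_fun setT (Re \o f) -> measurable_fun setT (Im \o f) ->
  measurable_fun setT (fun x => (normc (f x) ^+ 2)%:E).
Proof.
move=> mr mi; apply/measurable_EFinP.
under eq_fun do rewrite normc_sqr.
by apply: measurable_funD; apply: measurable_funX.
Qed.

Lemma normc_sqrD (a : R[i]) (z w : R[i]) :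
  normc (a * z + w) ^+ 2 <= 2 * normc a ^+ 2 * normc z ^+ 2 + 2 * normc w ^+ 2.
Proof.
apply: (@le_trans _ _ ((normc a * normc z + normc w) ^+ 2)).
  by rewrite -Normc.normcM ler_pXn2r ?nnegrE ?addr_ge0 ?normc_ge0// le_normcD.
have := sqr_ge0 (normc a * normc z - normc w); nra.
Qed.

Lemma L2_fun_submod_closed : submod_closed L2_fun_pred.
Proof.
split=> [|a f g].
  rewrite inE; split; [exact: measurable_cst|exact: measurable_cst|].
  under eq_integral do rewrite normc_sqr /= !expr0n/= addr0.
  by rewrite integral0.
rewrite !inE => -[mrf mif intf] [mrg mig intg].
have mr : measurable_fun setT (Re \o (a *: f + g)).
  rewrite (_ : _ \o _ = fun x => Re a * Re (f x) - Im a * Im (f x) + Re (g x)).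
    by apply: measurable_funD => //; apply: measurable_funB; apply: measurable_funM.
  by apply/funext => x /=; rewrite !fctE; case: (f x) (g x) (a) => [? ?] [? ?] [].
have mi : measurable_fun setT (Im \o (a *: f + g)).
  rewrite (_ : _ \o _ = fun x => Re a * Im (f x) + Im a * Re (f x) + Im (g x)).
    by apply: measurable_funD => //; apply: measurable_funD; apply: measurable_funM.
  by apply/funext => x /=; rewrite !fctE; case: (f x) (g x) (a) => [? ?] [? ?] [].
split => //.
have mf2 := measurable_normc_sqr mrf mif.
have mg2 := measurable_normc_sqr mrg mig.
apply: (@le_lt_trans _ _ (\int[mu]_x ((2 * normc a ^+ 2)%:E * (normc (f x) ^+ 2)%:E
   + 2%:E * (normc (g x) ^+ 2)%:E))%E).
  apply: ge0_le_integral => //.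
  - by move=> x _; rewrite lee_fin sqr_ge0.
  - exact: measurable_normc_sqr.
  - by apply: emeasurable_funD; apply: measurable_funeM.
  - by move=> x _; rewrite -!EFinM -EFinD lee_fin normc_sqrD.
have k0 : 0 <= 2 * normc a ^+ 2 by apply: mulr_ge0 => //; exact: sqr_ge0.
have sq0 (h : T -> R[i]) x : (0 <= (normc (h x) ^+ 2)%:E)%E.
  by rewrite lee_fin sqr_ge0.
rewrite ge0_integralD//=.
- rewrite !ge0_integralZl_EFin//.
  by rewrite lte_add_pinfty// lte_mul_pinfty// lee_fin.
- by move=> x _; rewrite mule_ge0.
- by apply: measurable_funeM.
- by move=> x _; rewrite mule_ge0.
- by apply: measurable_funeM.
Qed.

HB.instance Definition _ :=
  GRing.isSubmodClosed.Build _ _ L2_fun_pred L2_fun_submod_closed.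

Record L2_fun := MkL2Fun {
  L2_fun_val :> T -> R[i];
  _ : L2_fun_val \in L2_fun_pred }.

HB.instance Definition _ := [isSub for L2_fun_val].
HB.instance Definition _ := [Choice of L2_fun by <:].
HB.instance Definition _ := [SubChoice_isSubLmodule of L2_fun by <:].

Lemma L2_funP (f : L2_fun) :
  [/\ measurable_fun setT (Re \o f), measurable_fun setT (Im \o f)
    & (\int[mu]_x (normc (f x) ^+ 2)%:E < +oo)%E].
Proof. exact: (set_mem (valP f)). Qed.

Definition L2_null : {pred L2_fun} :=
  mem [set f : L2_fun | {ae mu, forall x, f x = 0}].

Lemma L2_null_zmod_closed : zmod_closed L2_null.
Proof.
split=> [|f g]; first by rewrite inE; exact: aeW.
rewrite !inE /= => f0 g0; near=> x.
rewrite -[X in X = _]/(f x - g x).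
have -> : f x = 0 by near: x; exact: f0.
have -> : g x = 0 by near: x; exact: g0.
by rewrite subr0.
Unshelve. all: by end_near. Qed.

HB.instance Definition _ :=
  GRing.isZmodClosed.Build _ L2_null L2_null_zmod_closed.

(* Classes modulo equality mu-almost everywhere, see L2_piP; operations below
   act on representatives and the *_pi lemmas give independence of the choice. *)
Definition L2 : Type := Quotient.quot L2_null.
HB.instance Definition _ := GRing.Zmodule.on L2.
Local Open Scope quotient_scope.
HB.instance Definition _ := EqQuotient.on L2.

Implicit Types f g : L2_fun.

Lemma L2_piP f g : (\pi_L2 f = \pi_L2 g) <-> {ae mu, forall x, f x = g x}.
Proof.
have -> : (\pi_L2 f = \pi_L2 g) <-> f - g \in L2_null.
  by rewrite Quotient.idealrBE; split=> [->//|/eqP].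
rewrite inE/=; split; apply: filterS => x.
  by move=> /eqP; rewrite subr_eq0 => /eqP.
by move=> fgx; apply/eqP; rewrite subr_eq0; exact/eqP.
Qed.

Lemma L2_piD f g : \pi_L2 (f + g) = \pi_L2 f + \pi_L2 g.
Proof. exact: Quotient.pi_add. Qed.

Lemma L2_reprK f : {ae mu, forall x, repr (\pi_L2 f) x = f x}.
Proof. by apply/L2_piP; rewrite reprK. Qed.

Definition L2_scale (a : R[i]) (h : L2) : L2 := \pi_L2 (a *: repr h).

Lemma L2_scale_pi a f : L2_scale a (\pi_L2 f) = \pi_L2 (a *: f).
Proof.
apply/L2_piP; apply: filterS (L2_reprK f) => x fx.
exact: (congr1 (fun z : R[i] => a *: z) fx).
Qed.

Let L2_scaleA a b h : L2_scale a (L2_scale b h) = L2_scale (a * b) h.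
Proof. by rewrite [LHS]L2_scale_pi scalerA. Qed.

Let L2_scale1 : left_id 1 L2_scale.
Proof. by move=> h; rewrite /L2_scale scale1r reprK. Qed.

Let L2_scaleDr : right_distributive L2_scale +%R.
Proof.
move=> a h k; rewrite -{1}[h]reprK -{1}[k]reprK -L2_piD.
by rewrite L2_scale_pi scalerDr L2_piD.
Qed.

Let L2_scaleDl h : {morph L2_scale^~ h : a b / a + b}.
Proof. by move=> a b; rewrite /L2_scale scalerDl L2_piD. Qed.

HB.instance Definition _ := GRing.Zmodule_isLmodule.Build R[i] L2
  L2_scaleA L2_scale1 L2_scaleDr L2_scaleDl.

(* Linear in the first argument. *)
Definition L2_inner (h k : L2) : R[i] :=
  complex_integral (fun x => repr h x * conjc (repr k x)).

Lemma L2_inner_pi f g :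
  L2_inner (\pi_L2 f) (\pi_L2 g) = complex_integral (fun x => f x * conjc (g x)).
Proof.
have mfg (u v : L2_fun) :
    measurable_fun setT (fun x => Re (u x * conjc (v x))) /\
    measurable_fun setT (fun x => Im (u x * conjc (v x))).
  have [mru miu _] := L2_funP u; have [mrv miv _] := L2_funP v; split.
    rewrite (_ : (fun _ => _) = fun x => Re (u x) * Re (v x) + Im (u x) * Im (v x)).
      by apply: measurable_funD; apply: measurable_funM.
    by apply/funext => x; case: (u x) (v x) => [? ?] [? ?] /=; ring.
  rewrite (_ : (fun _ => _) = fun x => Im (u x) * Re (v x) - Re (u x) * Im (v x)).
    by apply: measurable_funB; apply: measurable_funM.
  by apply/funext => x; case: (u x) (v x) => [? ?] [? ?] /=; ring.
rewrite /L2_inner /complex_integral /Rintegral; congr (fine _ +i* fine _);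
  apply: ae_eq_integral => //; try (by apply/measurable_EFinP; case: (mfg f g));
  try (by apply/measurable_EFinP; case: (mfg (repr (\pi_L2 f)) (repr (\pi_L2 g))));
  by apply: filterS2 (L2_reprK f) (L2_reprK g) => x fx gx _; rewrite fx gx.
Qed.

Definition L2_norm (h : L2) : R := Num.sqrt (Re (L2_inner h h)).

Definition L2_bounded (A : L2 -> L2) :=
  exists M : R, forall h, L2_norm (A h) <= M * L2_norm h.

End L2_space.

Definition mutually_singular {d} {T : measurableType d} {R : realType}
    (mu nu : {measure set T -> \bar R}) :=
  exists N : set T, [/\ measurable N, mu N = 0%E & nu (~` N) = 0%E].

Section circle_L2.
Context {R : realType} (mu : {finite_measure set (circle R) -> \bar R}).
Local Notation T := (circle R).
Local Notation normc := Normc.normc.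
Local Open Scope quotient_scope.

Lemma continuous_in_L2_fun (phi : continuousType T R[i]) :
  (phi : T -> R[i]) \in L2_fun_pred mu.
Proof.
have cr : continuous (Re \o phi).
  by move=> z; apply: continuous_comp; [exact: cts_fun|exact: continuous_Re].
have ci : continuous (Im \o phi).
  by move=> z; apply: continuous_comp; [exact: cts_fun|exact: continuous_Im].
have [M1 h1] := continuous_circle_bounded cr.
have [M2 h2] := continuous_circle_bounded ci.
have mr := continuous_circle_measurable cr.
have mi := continuous_circle_measurable ci.
rewrite inE; split => //.
apply: (@le_lt_trans _ _ (\int[mu]_x (M1 ^+ 2 + M2 ^+ 2)%:E)%E).
  apply: ge0_le_integral => //.
  - by move=> x _; rewrite lee_fin sqr_ge0.
  - exact: measurable_normc_sqr.
  - move=> x _; rewrite lee_fin normc_sqr -(real_normK (num_real (Re _))).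
    rewrite -(real_normK (num_real (Im _))).
    by apply: lerD; rewrite lerXn2r ?nnegrE ?(le_trans _ (h1 x))
      ?(le_trans _ (h2 x)) ?h1 ?h2.
rewrite integral_cst// lte_mul_pinfty// ?lee_fin ?addr_ge0 ?sqr_ge0//.
by rewrite -ge0_fin_numE ?fin_num_measure.
Qed.

Definition continuous_L2 (phi : continuousType T R[i]) : L2 mu :=
  \pi_(L2 mu) (MkL2Fun (continuous_in_L2_fun phi)).

Lemma circle_shift_in_L2_fun (f : L2_fun mu) :
  (fun z : T => circle_val z * f z) \in L2_fun_pred mu.
Proof.
have cr : continuous (Re \o @circle_val R).
  move=> z; apply: continuous_comp; first exact: continuous_circle_val.
  exact: continuous_Re.
have ci : continuous (Im \o @circle_val R).
  move=> z; apply: continuous_comp; first exact: continuous_circle_val.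
  exact: continuous_Im.
have mr := continuous_circle_measurable cr.
have mi := continuous_circle_measurable ci.
have [mrf mif ff] := L2_funP f; rewrite inE; split.
- rewrite (_ : _ \o _ = fun x => Re (circle_val x) * Re (f x)
                                 - Im (circle_val x) * Im (f x)).
    by apply: measurable_funB; apply: measurable_funM.
  by apply/funext => x /=; case: (circle_val x) (f x) => [? ?] [? ?] /=; ring.
- rewrite (_ : _ \o _ = fun x => Re (circle_val x) * Im (f x)
                                 + Im (circle_val x) * Re (f x)).
    by apply: measurable_funD; apply: measurable_funM.
  by apply/funext => x /=; case: (circle_val x) (f x) => [? ?] [? ?] /=; ring.
- rewrite (eq_integral (fun x => (normc (f x) ^+ 2)%:E))// => z _.
  rewrite Normc.normcM (_ : normc (circle_val z) = 1) ?mul1r//.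
  have : unit_circle (circle_val z) by exact: (set_mem (valP z)).
  by move=> /(congr1 (@complex.Re R)).
Qed.

Definition circle_shift_fun (f : L2_fun mu) : L2_fun mu :=
  MkL2Fun (circle_shift_in_L2_fun f).

Definition circle_shift (h : L2 mu) : L2 mu :=
  \pi_(L2 mu) (circle_shift_fun (repr h)).

Lemma circle_shift_pi (f : L2_fun mu) :
  circle_shift (\pi_(L2 mu) f) = \pi_(L2 mu) (circle_shift_fun f).
Proof. by apply/L2_piP; apply: filterS (L2_reprK f) => z /= ->. Qed.

End circle_L2.

(* Main.v *)
Require Import Defs.
From HB Require Import structures.
From mathcomp Require Import all_boot all_order all_algebra complex ring lra.
From mathcomp Require Import all_classical all_reals all_analysis.
From mathcomp Require Import measurable_realfun.
Import Order.TTheory GRing.Theory Num.Theory.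
Import numFieldNormedType.Exports.
Set Implicit Arguments. Unset Strict Implicit. Unset Printing Implicit Defensive.
Local Open Scope classical_set_scope.
Local Open Scope ring_scope.
Local Notation normc := Normc.normc.
Local Notation Re := (@complex.Re _).
Local Notation Im := (@complex.Im _).

(** Why the theorem holds.  A bounded [A] with
    [A U - U A = (., phi) 1 - (., 1) phi] cannot let [phi] vary fast near a
    point that carries much mass.  Indeed the left-hand side is unchanged when
    [U] is replaced by [U - w], and [U - w] has norm at most [delta] on functions
    supported within [delta] of [w].  Take [h] to be the indicator of a set [E]
    where [phi <= alpha], and compare the two sides on a set [F] where
    [beta <= phi], both within [delta] of [w].  On [F] the right-hand side is at
    least [(beta - alpha) mu(E)] in modulus, while the L^2 norm of the left-hand
    side over [F] is at most [2 |A| delta sqrt(mu(E))].  Hence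
    [(beta - alpha)^2 mu(E) mu(F) <= 4 |A|^2 delta^2] ([commutator_bound]).

    It remains to choose [mu] and [phi] violating this at every small scale.
    Let [mu] be the image of Lebesgue measure on [[0, 1[] under
    [x |-> exp (i g(x))], where [g(x) = sum_k floor(2^k x) / 16^k].  The function
    [g] is strictly increasing, so [mu] has no atom; it maps each dyadic interval
    of length [2^-n] into an interval of length [O(8^-n)], so its range has
    measure zero and [mu] is singular.  Near 0, [g] contracts [2^-n] to about
    [16^-n], so arcs of length of order [16^-n] near 1 have mass at least [2^-n].
    With [phi(z) = sqrt |z - 1|], [w = 1] and [delta] of order [16^-n] one gets
    [beta - alpha] of order [4^-n]; the bound would say
    [16^-n * 4^-n <= C |A|^2 * 256^-n], which fails for large [n]. *)

(** * A bound that every bounded solution of the commutator equation satisfies *)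

Section L2_norm.
Context {d} {T : measurableType d} {R : realType}.
Variable mu : {measure set T -> \bar R}.
Local Open Scope quotient_scope.

Lemma L2_norm_piE (f : L2_fun mu) :
  ((L2_norm (\pi_(L2 mu) f) ^+ 2)%:E = \int[mu]_x (normc (f x) ^+ 2)%:E)%E.
Proof.
have [mr mi fin] := L2_funP f.
have int0 : (0 <= \int[mu]_x (normc (f x) ^+ 2)%:E)%E.
  by apply: integral_ge0 => x _; rewrite lee_fin sqr_ge0.
rewrite /L2_norm L2_inner_pi /=.
rewrite (_ : Rintegral _ _ _ = fine (\int[mu]_x (normc (f x) ^+ 2)%:E)%E).
  by rewrite sqr_sqrtr ?fine_ge0// fineK// ge0_fin_numE.
congr fine; apply: eq_integral => x _; congr EFin.
by rewrite normc_sqr; case: (f x) => a b /=; ring.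
Qed.

End L2_norm.

Section commutator.
Context {R : realType} (mu : {finite_measure set (circle R) -> \bar R}).
Local Notation T := (circle R).
Local Open Scope quotient_scope.

Lemma indic_in_L2_fun (E : set T) : measurable E ->
  (fun z => (\1_E z)%:C%C : R[i]) \in L2_fun_pred mu.
Proof.
move=> mE; rewrite inE; split.
- exact: (@measurable_indic _ T R setT E mE).
- exact: measurable_cst.
- rewrite (eq_integral (fun z => (\1_E z)%:E)).
    by rewrite integral_indic// setIT -ge0_fin_numE// fin_num_measure.
  by move=> z _; rewrite normc_sqr/= expr0n/= addr0 indicE; case: (_ \in _);
    rewrite ?expr1n ?expr0n.
Qed.

Definition indic_L2_fun (E : set T) (mE : measurable E) : L2_fun mu :=
  MkL2Fun (indic_in_L2_fun mE).

Lemma L2_pi_comb (f g : L2_fun mu) (a b : R[i]) :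
  a *: \pi_(L2 mu) f - b *: \pi_(L2 mu) g = \pi_(L2 mu) (a *: f - b *: g).
Proof.
rewrite -scaleN1r -[a *: \pi_(L2 mu) f]/(L2_scale _ _).
rewrite -[b *: \pi_(L2 mu) g]/(L2_scale _ _) -[-1 *: _]/(L2_scale _ _).
by rewrite !L2_scale_pi -L2_piD scaleN1r.
Qed.

Lemma L2_shift_sub (f : L2_fun mu) (w : R[i]) :
  circle_shift (\pi_(L2 mu) f) - w *: \pi_(L2 mu) f =
  \pi_(L2 mu) (circle_shift_fun f - w *: f).
Proof.
rewrite circle_shift_pi -{1}[\pi_(L2 mu) (circle_shift_fun f)]scale1r.
by rewrite L2_pi_comb scale1r.
Qed.

Lemma L2_norm_shift_sub (E : set T) (mE : measurable E) (w : R[i]) (delta : R) :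
  (forall z, E z -> normc (circle_val z - w) <= delta) ->
  L2_norm (circle_shift (\pi_(L2 mu) (indic_L2_fun mE)) -
           w *: \pi_(L2 mu) (indic_L2_fun mE)) ^+ 2 <= delta ^+ 2 * fine (mu E).
Proof.
move=> dE; rewrite L2_shift_sub -lee_fin L2_norm_piE EFinM fineK ?fin_num_measure//.
have -> : mu E = (\int[mu]_z (\1_E z)%:E)%E by rewrite integral_indic// setIT.
rewrite -ge0_integralZl_EFin ?sqr_ge0//; last first.
  exact/measurable_EFinP/measurable_indic.
have [mr mi _] := L2_funP (circle_shift_fun (indic_L2_fun mE) - w *: indic_L2_fun mE).
apply: ge0_le_integral => //.
- by move=> z _; rewrite lee_fin sqr_ge0.
- exact: measurable_normc_sqr.
- apply: measurable_funeM; exact/measurable_EFinP/measurable_indic.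
- move=> z _; rewrite -EFinM lee_fin.
  rewrite (_ : (_ - _ : L2_fun mu) z = (circle_val z - w) * (\1_E z)%:C%C); last first.
    by rewrite mulrBl.
  rewrite Normc.normcM exprMn indicE; case: (boolP (z \in E)) => [/set_mem zE|_].
    have d0 := le_trans (Defs.normc_ge0 _) (dE z zE).
    rewrite /= expr0n expr1n addr0 sqrtr1 expr1n !mulr1.
    by rewrite ler_pXn2r ?nnegrE ?Defs.normc_ge0 ?dE.
  by rewrite /= expr0n/= addr0 sqrtr0 expr0n/= !mulr0.
Qed.

Lemma L2_inner_indic_real (E : set T) (mE : measurable E)
    (phi : continuousType T R[i]) (f : T -> R) :
  (forall z, phi z = (f z)%:C%C) ->
  L2_inner (\pi_(L2 mu) (indic_L2_fun mE)) (continuous_L2 mu phi) =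
  (\int[mu]_(z in E) f z)%:C%C.
Proof.
move=> phiE; rewrite /continuous_L2 L2_inner_pi /complex_integral.
apply/eqP; rewrite eq_complex /=; apply/andP; split; apply/eqP.
  rewrite [RHS]Rintegral_mkcond; congr fine; apply: eq_integral => z _; congr EFin.
  rewrite phiE/= patchE indicE.
  by case: (_ \in _); rewrite ?mul1r ?mul0r/= ?mul0r subr0.
rewrite /Rintegral.
transitivity (fine (\int[mu]_(z in setT) (cst 0%E z))%E); last by rewrite integral0.
congr fine; apply: eq_integral => z _; congr EFin.
by rewrite phiE/=; ring.
Qed.

Lemma Rintegral_le_cst (E : set T) (f : T -> R) (c : R) :
  measurable E -> continuous f -> (forall z, E z -> f z <= c) ->
  \int[mu]_(z in E) f z <= c * fine (mu E).
Proof.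
move=> mE cf fc; rewrite -Rintegral_cst//; apply: le_Rintegral => //.
  have [M fM] := continuous_circle_bounded cf.
  apply: measurable_bounded_integrable => //.
  - by rewrite -ge0_fin_numE// fin_num_measure.
  - exact: measurable_funTS (continuous_circle_measurable cf).
  - exists M; split; first exact: num_real.
    by move=> N MN z _ /=; rewrite (le_trans (fM z))// ltW.
exact: finite_measure_integrable_cst.
Qed.

Lemma normcB_sqr (a b u : R[i]) (delta : R) : normc u <= delta ->
  normc (a - u * b) ^+ 2 <= 2 * normc a ^+ 2 + 2 * delta ^+ 2 * normc b ^+ 2.
Proof.
move=> ud; have := normc_sqrD (- u) b a; rewrite mulNr addrC => /le_trans; apply.
have -> : normc (- u) = normc u by case: (u) => x y /=; rewrite !sqrrN.
rewrite addrC lerD2l ler_wpM2r ?sqr_ge0// ler_wpM2l//.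
have u0 := Defs.normc_ge0 u.
by rewrite ler_pXn2r ?nnegrE// (le_trans u0).
Qed.

(** Replacing [circle_shift] by [circle_shift - w] does not change the
    commutator, and makes both of its terms small near [w]: [circle_shift - w]
    acts on the indicator of [E] before [A], and multiplies by [z - w] on [F]
    after [A].  Evaluating the equation pointwise on [F] and integrating the
    squared modulus there avoids any inner product of the unknown functions. *)
Lemma commutator_bound (phi : continuousType T R[i]) (f : T -> R)
    (A : {linear L2 mu -> L2 mu}) (M : R) (E F : set T) (w : R[i])
    (alpha beta delta : R) :
  measurable E -> measurable F ->
  continuous f -> (forall z, phi z = (f z)%:C%C) ->
  (forall h, L2_norm (A h) <= M * L2_norm h) ->
  (forall h, A (circle_shift h) - circle_shift (A h) =
     L2_inner h (continuous_L2 mu phi) *: continuous_L2 mu (cst 1) -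
     L2_inner h (continuous_L2 mu (cst 1)) *: continuous_L2 mu phi) ->
  alpha <= beta ->
  (forall z, E z -> f z <= alpha) -> (forall z, F z -> beta <= f z) ->
  (forall z, (E `|` F) z -> normc (circle_val z - w) <= delta) ->
  (0 < mu E)%E ->
  (beta - alpha) ^+ 2 * (fine (mu E) * fine (mu F)) <= 4 * M ^+ 2 * delta ^+ 2.
Proof.
move=> mE mF cf phiE AM comm ab fE fF dEF E0.
set h := \pi_(L2 mu) (indic_L2_fun mE).
pose massE := fine (mu E).
have massE0 : 0 < massE by rewrite fine_gt0// E0 -ge0_fin_numE// fin_num_measure.
have normh : L2_norm h ^+ 2 = massE.
  apply/EFin_inj; rewrite /h L2_norm_piE fineK ?fin_num_measure//.
  rewrite -[in RHS](setIT E) -integral_indic//; apply: eq_integral => z _.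
  rewrite normc_sqr/= expr0n/= addr0 indicE; congr EFin.
  by case: (_ \in _); rewrite ?expr1n ?expr0n.
have sqrA k : L2_norm (A k) ^+ 2 <= M ^+ 2 * L2_norm k ^+ 2.
  rewrite -exprMn ler_pXn2r ?nnegrE ?sqrtr_ge0 ?AM//.
  exact: le_trans (sqrtr_ge0 _) (AM k).
pose a := repr (A h).
pose b := repr (A (circle_shift h - w *: h)).
have Ea : \pi_(L2 mu) a = A h by exact: reprK.
have Eb : \pi_(L2 mu) b = A (circle_shift h - w *: h) by exact: reprK.
have na : (\int[mu]_z (normc (a z) ^+ 2)%:E <= (M ^+ 2 * massE)%:E)%E.
  by rewrite -L2_norm_piE Ea lee_fin -normh.
have nb : (\int[mu]_z (normc (b z) ^+ 2)%:E <= (M ^+ 2 * (delta ^+ 2 * massE))%:E)%E.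
  rewrite -L2_norm_piE Eb lee_fin (le_trans (sqrA _))//.
  rewrite ler_wpM2l ?sqr_ge0// L2_norm_shift_sub// => z Ez; apply: dEF; by left.
(* The equation at the indicator of E, written with representatives; the two
   inner products are the integral of f over E and the mass of E. *)
have keyae : {ae mu, forall z, b z - (circle_val z - w) * a z =
    ((\int[mu]_(z in E) f z)%:C%C - (massE)%:C%C * (f z)%:C%C)}.
  have := comm h.
  rewrite (L2_inner_indic_real mE phiE) (@L2_inner_indic_real _ _ _ (cst 1))//.
  rewrite Rintegral_cst// mul1r.
  rewrite /continuous_L2 L2_pi_comb.
  have -> : A (circle_shift h) - circle_shift (A h) =
      A (circle_shift h - w *: h) - (circle_shift (A h) - w *: A h).
    by rewrite linearB linearZ/= opprB addrA subrK.
  rewrite -Eb -Ea (L2_shift_sub a w) -[\pi_(L2 mu) b]scale1r.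
  rewrite -[\pi_(L2 mu) (_ - _)]scale1r L2_pi_comb => /L2_piP.
  apply: filterS => z; rewrite /= !scale1r.
  by rewrite mulrBl -phiE => e; rewrite -[X in _ = X - _]mulr1; exact: e.
have [mra mia _] := L2_funP a; have [mrb mib _] := L2_funP b.
have ma := measurable_normc_sqr mra mia; have mb := measurable_normc_sqr mrb mib.
pose c := ((beta - alpha) * massE) ^+ 2.
pose G z : \bar R := (2%:E * (normc (b z) ^+ 2)%:E +
  (2 * delta ^+ 2)%:E * (normc (a z) ^+ 2)%:E)%E.
have d20 : 0 <= 2 * delta ^+ 2 by rewrite mulr_ge0// sqr_ge0.
have t0 z : (0 <= 2%:E * (normc (b z) ^+ 2)%:E)%E.
  by rewrite mule_ge0// lee_fin sqr_ge0.
have t1 z : (0 <= (2 * delta ^+ 2)%:E * (normc (a z) ^+ 2)%:E)%E.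
  by rewrite mule_ge0// lee_fin// sqr_ge0.
have G0 z : (0 <= G z)%E by rewrite adde_ge0.
have mt0 := measurable_funeM 2%:E mb.
have mt1 := measurable_funeM (2 * delta ^+ 2)%:E ma.
have mG : measurable_fun setT G by exact: emeasurable_funD.
(* On F the modulus of the right-hand side is bounded below because the integral
   of f over E is at most alpha mu(E), while mu(E) f(z) >= beta mu(E). *)
have cG : {ae mu, forall z, F z -> (c%:E <= G z)%E}.
  apply: filterS keyae => z e Fz.
  rewrite /G -!EFinM -EFinD lee_fin.
  apply: le_trans (normcB_sqr (b z) (a z) (dEF z (or_intror Fz))).
  rewrite e normc_sqr /c/=.
  have i1 := Rintegral_le_cst mE cf fE.
  have i2 : beta * massE <= massE * f z by rewrite mulrC ler_pM2l// fF.
  have i3 : 0 <= (beta - alpha) * massE by rewrite mulr_ge0 ?subr_ge0// ltW.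
  rewrite mul0r mulr0 mul0r addr0 !subr0 expr0n addr0 -[leRHS]sqrrN opprB.
  have i4 : (beta - alpha) * massE <= massE * f z - \int[mu]_(z0 in E) f z0.
    by rewrite mulrBl lerB.
  by rewrite ler_pXn2r ?nnegrE ?(le_trans i3).
have intG : (\int[mu]_z G z <= (4 * M ^+ 2 * delta ^+ 2 * massE)%:E)%E.
  rewrite ge0_integralD// !ge0_integralZl_EFin//; last 2 first.
  - by move=> z _; rewrite lee_fin sqr_ge0.
  - by move=> z _; rewrite lee_fin sqr_ge0.
  apply: le_trans (leeD (lee_wpmul2l _ nb) (lee_wpmul2l _ na)) _ => //.
  rewrite -!EFinM -EFinD lee_fin.
  rewrite [leRHS](_ : _ = 2 * (M ^+ 2 * (delta ^+ 2 * massE)) +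
                          2 * delta ^+ 2 * (M ^+ 2 * massE)); first exact: lexx.
  by ring.
have : (c%:E * mu F <= (4 * M ^+ 2 * delta ^+ 2 * massE)%:E)%E.
  apply: le_trans intG; rewrite -integral_cst//.
  apply: (@le_trans _ _ (\int[mu]_(z in F) G z)%E).
    apply: ae_ge0_le_integral => //.
      by move=> z _; rewrite lee_fin sqr_ge0.
    exact: measurable_funTS.
  exact: ge0_subset_integral.
rewrite -[mu F]fineK ?fin_num_measure// -EFinM lee_fin /c exprMn.
rewrite -/massE => H; rewrite -(ler_pM2r massE0); apply: le_trans H.
rewrite [leLHS](_ : _ = (beta - alpha) ^+ 2 * massE ^+ 2 * fine (mu F)) ?lexx//.
by ring.
Qed.

End commutator.

(** * A strictly increasing function with null range *)

Section jump.
Context {R : realType}.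
Implicit Types x y : R.

Definition jump_sum x (m : nat) : R :=
  \sum_(0 <= k < m) (Num.floor (2 ^+ k * x))%:~R / 16 ^+ k.

(** A supremum rather than a limit: on nonnegative [x] the partial sums increase,
    so this is the sum of the series, and comparisons reduce to partial sums. *)
Definition jump x : R := sup (range (jump_sum x)).

Lemma jump_sum_cat x n m : (n <= m)%N ->
  jump_sum x m =
  jump_sum x n + \sum_(n <= k < m) (Num.floor (2 ^+ k * x))%:~R / 16 ^+ k.
Proof. by move=> nm; rewrite /jump_sum (big_cat_nat (n := n)). Qed.

Lemma jump_term_le x y k : x <= y ->
  (Num.floor (2 ^+ k * x))%:~R / 16 ^+ k <= (Num.floor (2 ^+ k * y))%:~R / 16 ^+ k :> R.
Proof.
move=> xy; rewrite ler_wpM2r ?invr_ge0 ?exprn_ge0// ler_int le_floor//.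
by rewrite ler_wpM2l// exprn_ge0.
Qed.

Lemma jump_term_ge0 x k : 0 <= x -> 0 <= (Num.floor (2 ^+ k * x))%:~R / 16 ^+ k :> R.
Proof.
move=> x0; rewrite mulr_ge0 ?invr_ge0 ?exprn_ge0// ler0z floor_ge0.
by rewrite mulr_ge0// exprn_ge0.
Qed.

Lemma jump_sum_homo x : 0 <= x -> {homo jump_sum x : m n / (m <= n)%N >-> m <= n}.
Proof.
move=> x0 m n mn; rewrite (jump_sum_cat x mn) lerDl.
by apply: sumr_ge0 => k _; exact: jump_term_ge0.
Qed.

Lemma jump_sum_le x y m : x <= y -> jump_sum x m <= jump_sum y m.
Proof. by move=> xy; apply: ler_sum => k _; exact: jump_term_le. Qed.

(** [floor (2^k x) / 16^k <= x / 8^k], and [8/7 / 8^n] is the sum of [8^-k] over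
    [k >= n]; writing each [8^-k] as [8/7 (8^-k - 8^-(k+1))] makes it telescope. *)
Lemma jump_sum_tail x n m : 0 <= x ->
  jump_sum x m <= jump_sum x n + 8 / 7 * x / 8 ^+ n.
Proof.
move=> x0.
have p8 k : 0 < 8 ^+ k :> R by rewrite exprn_gt0.
have [mn|/ltnW nm] := leqP m n.
  rewrite (le_trans (jump_sum_homo x0 mn))// lerDl.
  by rewrite !mulr_ge0// invr_ge0 ltW.
rewrite (jump_sum_cat x nm) lerD2l.
apply: (@le_trans _ _ (\sum_(n <= k < m) 8 / 7 * x * ((8 ^+ k)^-1 - (8 ^+ k.+1)^-1))).
  apply: ler_sum => k _.
  rewrite (_ : _ * (_ - _) = 2 ^+ k * x / 16 ^+ k).
    by rewrite ler_wpM2r ?invr_ge0 ?exprn_ge0// floor_le.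
  rewrite exprS (_ : 16 = 2 * 8 :> R) ?exprMn; last by ring.
  have p2 : (2 : R) ^+ k != 0 by rewrite expf_neq0.
  by field; rewrite p2 lt0r_neq0.
rewrite -mulr_sumr ler_wpM2l ?mulr_ge0//.
rewrite (@telescope_sumr_eq _ _ _ (fun k => - (8 ^+ k)^-1)) => [||k _]//; last first.
  by rewrite opprK addrC.
by rewrite opprK gerDr oppr_le0 invr_ge0 ltW.
Qed.

Lemma jump_sum_ubound x : has_ubound (range (jump_sum x)).
Proof.
exists (8 / 7 * `|x|) => _ [m _ <-].
rewrite (le_trans (jump_sum_le m (ler_norm x)))//.
have := @jump_sum_tail `|x| 0 m (normr_ge0 x).
by rewrite [jump_sum _ 0]big_geq// add0r expr0 divr1.
Qed.

Lemma jump_sum_le_jump x m : jump_sum x m <= jump x.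
Proof. by apply: ub_le_sup; [exact: jump_sum_ubound|exists m]. Qed.

Lemma jump_le x c : (forall m, jump_sum x m <= c) -> jump x <= c.
Proof.
by move=> xc; apply: ge_sup; [exists (jump_sum x 0), 0%N|move=> _ [m _ <-]].
Qed.

Lemma jump_le_tail x n : 0 <= x -> jump x <= jump_sum x n + 8 / 7 * x / 8 ^+ n.
Proof. by move=> x0; apply: jump_le => m; exact: jump_sum_tail. Qed.

Lemma jump_nondecreasing : {homo jump : x y / x <= y}.
Proof.
move=> x y xy; apply: jump_le => m.
exact: le_trans (jump_sum_le m xy) (jump_sum_le_jump y m).
Qed.

(** As soon as [2^k (y - x) >= 1] the [k]-th floors differ by at least one, which
    separates the two sums by [16^-k]. *)
Lemma jump_increasing x y : 0 <= x -> x < y -> jump x < jump y.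
Proof.
move=> x0 xy; have yx0 : 0 < y - x by rewrite subr_gt0.
have p2 k : 0 < 2 ^+ k :> R by rewrite exprn_gt0.
pose k := (Num.truncn (y - x)^-1).+1.
have k1 : 1 <= 2 ^+ k * (y - x).
  rewrite -ler_pdivrMr// mul1r.
  apply: (@le_trans _ _ k%:R); first exact: ltW (truncnS_gt _).
  by rewrite -natrX ler_nat ltnW// ltn_expl.
have k16 : (0 : R) < 16 ^- k by rewrite invr_gt0 exprn_gt0.
suff : jump x <= jump y - 16 ^- k by lra.
apply: jump_le => m.
rewrite (le_trans (jump_sum_homo x0 (leq_maxl m k.+1)))//.
rewrite lerBrDr (le_trans _ (jump_sum_le_jump y (maxn m k.+1)))//.
have kK : (k < maxn m k.+1)%N by rewrite leq_max ltnSn orbT.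
rewrite /jump_sum !big_mkord !(bigD1 (Ordinal kK) isT)/= addrAC.
apply: lerD; last first.
  by apply: ler_sum => i _; apply: jump_term_le; exact: ltW.
rewrite -[X in _ + X]mul1r -mulrDl ler_wpM2r ?(ltW k16)//.
rewrite -(intrD _ _ 1) ler_int floor_ge_int intrD.
have := floor_le (2 ^+ k * x); move: k1; rewrite mulrBr; lra.
Qed.

(** The floors vanish up to rank [n], so only the tail after [n] remains. *)
Lemma jump_small x n : 0 <= x -> 2 ^+ n * x < 1 -> jump x <= 16 ^- n / 7.
Proof.
move=> x0 xn; apply: (le_trans (jump_le_tail n.+1 x0)).
rewrite /jump_sum big1_seq ?add0r => [|k].
  have p8 : (0 : R) < 8 ^+ n by rewrite exprn_gt0.
  have p2 : (0 : R) < 2 ^+ n by rewrite exprn_gt0.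
  rewrite (_ : _ / _ = 2 ^+ n * x * (16 ^- n / 7)).
    by rewrite ler_piMl ?ltW// divr_ge0// invr_ge0 exprn_ge0.
  rewrite exprS (_ : 16 = 2 * 8 :> R) ?exprMn; last by ring.
  by field; rewrite !lt0r_neq0.
rewrite mem_index_iota/= => kn.
suff -> : Num.floor (2 ^+ k * x) = 0 by rewrite mul0r.
apply/eqP; rewrite floor_eq/= mulr_ge0 ?exprn_ge0//=.
by rewrite (le_lt_trans _ xn)// ler_wpM2r// ler_eXn2l// ltrDl.
Qed.

(** The term of rank [n] alone is at least [16^-n]. *)
Lemma jump_large x n : 1 <= 2 ^+ n * x -> 16 ^- n <= jump x.
Proof.
move=> xn; have x0 : 0 <= x.
  by rewrite -(@pmulr_rge0 _ (2 ^+ n)) ?exprn_gt0// (le_trans _ xn).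
apply: le_trans (jump_sum_le_jump x n.+1).
rewrite /jump_sum big_nat_recr//= -[leLHS]add0r lerD//.
  by apply: sumr_ge0 => k _; exact: jump_term_ge0.
by rewrite ler_peMl ?invr_ge0 ?exprn_ge0// ler1z floor_ge_int.
Qed.

(** The first [n] floors depend only on the dyadic interval
    [[j / 2^n, (j + 1) / 2^n[] containing [x]; the tail is [O(8^-n)].  So [2^n]
    intervals of length [2 / 8^n] cover the range on [[0, 1[]. *)
Lemma jump_bracket x n : 0 <= x < 1 -> exists2 j, (j < 2 ^ n)%N &
  jump_sum (j%:R / 2 ^+ n) n <= jump x <= jump_sum (j%:R / 2 ^+ n) n + 2 / 8 ^+ n.
Proof.
move=> /andP[x0 x1].
have p2 k : (0 : R) < 2 ^+ k by rewrite exprn_gt0.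
pose j := Num.truncn (2 ^+ n * x).
have /andP[jx xj] : j%:R <= 2 ^+ n * x < j.+1%:R.
  by apply: truncn_itv; rewrite mulr_ge0// ltW.
have jxn : j%:R / 2 ^+ n <= x by rewrite ler_pdivrMr// mulrC.
(* An integer i <= 2^k x gives the integer i 2^(n-k) <= 2^n x, hence at most j. *)
have jsE : jump_sum x n = jump_sum (j%:R / 2 ^+ n) n.
  apply: eq_big_nat => k /andP[_ kn]; congr (_%:~R / _); apply/le_anti/andP; split.
    rewrite floor_ge_int mulrA ler_pdivlMr//.
    have f0 : 0 <= Num.floor (2 ^+ k * x) by rewrite floor_ge0 mulr_ge0// ltW.
    have := floor_le (2 ^+ k * x).
    move: f0; case: (Num.floor _) => // i _; rewrite -pmulrn => ix.
    have nkE : (2 : R) ^+ n = 2 ^+ (n - k) * 2 ^+ k by rewrite -exprD subnK// ltnW.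
    have : (i * 2 ^ (n - k) <= j)%N.
      rewrite -ltnS -(ltr_nat R) natrM natrX; apply: le_lt_trans xj.
      by rewrite nkE -mulrA mulrC ler_wpM2l// ltW.
    rewrite -(ler_nat R) natrM natrX => ij.
    by rewrite nkE mulrA [leRHS]mulrC ler_wpM2r// ltW.
  by rewrite le_floor// ler_wpM2l// ltW.
exists j.
  rewrite -(ltr_nat R) natrX; apply: le_lt_trans jx _.
  by rewrite -[ltRHS]mulr1 ltr_pM2l.
rewrite -jsE jump_sum_le_jump/= (le_trans (jump_le_tail n x0))// lerD2l.
rewrite ler_wpM2r ?invr_ge0 ?exprn_ge0//; lra.
Qed.

End jump.

(** * The circle near the point 1 *)

Section trig.
Context {R : realType}.
Implicit Types t : R.

Lemma sin_le_id t : 0 <= t -> sin t <= t.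
Proof.
move=> t0; have [c _] := @MVT_segment R sin cos 0 t t0 (fun x _ => is_derive_sin x)
  (continuous_subspaceT (@continuous_sin R)).
rewrite sin0 !subr0 => ->.
by rewrite ler_piMl// cos_le1.
Qed.

Lemma cos_ge_1Bsqr t : 0 <= t -> 1 - t ^+ 2 <= cos t.
Proof.
move=> t0; have [c] := @MVT_segment R cos (fun x => - sin x) 0 t t0
  (fun x _ => is_derive_cos x) (continuous_subspaceT (@continuous_cos R)).
rewrite in_itv/= => /andP[c0 ct]; rewrite cos0 subr0.
have := sin_le_id c0; nra.
Qed.

Lemma sin_ge t : 0 <= t <= 2^-1 -> 3 / 4 * t <= sin t.
Proof.
move=> /andP[t0 t1]; have [c] := @MVT_segment R sin cos 0 t t0
  (fun x _ => is_derive_sin x) (continuous_subspaceT (@continuous_sin R)).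
rewrite in_itv/= => /andP[c0 ct]; rewrite sin0 !subr0 => ->.
have := cos_ge_1Bsqr c0 => h; rewrite ler_wpM2r//; nra.
Qed.

Definition dist1 (z : circle R) : R := normc (circle_val z - 1).

Lemma dist1_expi_sqr t : dist1 (circle_expi t) ^+ 2 = 2 - 2 * cos t.
Proof.
rewrite /dist1 normc_sqr/= subr0 sin2cos2; ring.
Qed.

Lemma dist1_expi_le t : 0 <= t -> dist1 (circle_expi t) ^+ 2 <= 2 * t ^+ 2.
Proof. by move=> t0; rewrite dist1_expi_sqr; have := cos_ge_1Bsqr t0; lra. Qed.

Lemma dist1_expi_ge t : 0 <= t <= 2^-1 -> 3 / 4 * t <= dist1 (circle_expi t).
Proof.
move=> t1; apply: le_trans (sin_ge t1) _.
have s0 : 0 <= sin t.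
  by apply: le_trans (sin_ge t1); case/andP: t1 => ? _; rewrite mulr_ge0.
rewrite -(@ler_pXn2r _ 2)// ?nnegrE ?Defs.normc_ge0//.
by rewrite dist1_expi_sqr sin2cos2; have := sqr_ge0 (1 - cos t); nra.
Qed.

Lemma continuous_dist1 : continuous dist1.
Proof.
pose g (z : circle R) := (Re (circle_val z) - 1) ^+ 2 + Im (circle_val z) ^+ 2.
have -> : dist1 = Num.sqrt \o g.
  apply/funext => z; rewrite /dist1 /g/=.
  by case: (circle_val z) => a b/=; rewrite subr0.
have cr : continuous (fun z : circle R => Re (circle_val z)).
  move=> z; apply: continuous_comp; first exact: continuous_circle_val.
  exact: continuous_Re.
have ci : continuous (fun z : circle R => Im (circle_val z)).
  move=> z; apply: continuous_comp; first exact: continuous_circle_val.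
  exact: continuous_Im.
move=> z; apply: continuous_comp; last exact: sqrt_continuous.
apply: continuousD; apply: (@continuous_comp _ _ _ _ (fun x : R => x ^+ 2));
  try exact: exprn_continuous; last exact: ci.
by apply: continuousB; [exact: cr|exact: cst_continuous].
Qed.

Lemma continuous_sqrt_dist1 :
  continuous (fun z => (Num.sqrt (dist1 z))%:C%C : R[i]).
Proof.
apply: continuous_complex => [z|]; last exact: cst_continuous.
by apply: continuous_comp; [exact: continuous_dist1|exact: sqrt_continuous].
Qed.

(** The first angle is in the upper half circle, where the sine is nonnegative;
    this rules out [t > pi], and the cosine is injective on [[0, pi]]. *)
Lemma circle_expi_inj (s t : R) : 0 <= s <= pi -> 0 <= t < 2 * pi ->
  circle_expi s = circle_expi t -> s = t.
Proof.
move=> /andP[s0 spi] /andP[t0 t2pi] /(congr1 val)/= [cst sst].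
have ss : 0 <= sin s.
  have := @sin_ge0_pi R s.
  by rewrite s0 spi; apply.
have [tpi|tpi] := leP t pi.
  by apply: (@cos_inj R); rewrite ?in_itv/= ?s0 ?t0.
have : 0 < sin (t - pi) by apply: sin_gt0_pi; lra.
by rewrite sinB sinpi cospi; lra.
Qed.

Lemma circle_hausdorff : hausdorff_space (circle R).
Proof.
move=> p q pq; apply: val_inj; apply: (@norm_hausdorff _ R[i]) => U V pU qV.
have [z [Uz Vz]] := pq _ _ (@continuous_circle_val R p U pU)
  (@continuous_circle_val R q V qV).
by exists (circle_val z).
Qed.

Lemma closed_circle_measurable (C : set (circle R)) : closed C -> measurable C.
Proof.
move=> cC; rewrite -(setCK C); apply: measurableC; apply: sub_sigma_algebra.
exact: closed_openC.
Qed.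

End trig.

(** * A singular measure without atoms *)

Section jump_measure.
Context {R : realType}.
Local Notation leb := (@lebesgue_measure R).

Definition jump_cover n : set R := \bigcup_(j in `I_(2 ^ n))
  `[jump_sum (j%:R / 2 ^+ n) n, jump_sum (j%:R / 2 ^+ n) n + 2 / 8 ^+ n]%classic.

(** A closed set containing the range of [jump] on [[0, 1[]; closedness makes its
    image on the circle compact, hence measurable. *)
Definition jump_support : set R := \bigcap_n jump_cover n.

Lemma jump_in_support (x : R) : 0 <= x < 1 -> jump_support (jump x).
Proof.
move=> x01 n _; have [j jn jb] := jump_bracket n x01.
by exists j => //=; rewrite in_itv.
Qed.

Lemma closed_jump_cover n : closed (jump_cover n).
Proof. by apply: closed_bigcup => // j _; exact: itv_closed. Qed.

Lemma closed_jump_support : closed jump_support.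
Proof. by apply: closed_bigI => n _; exact: closed_jump_cover. Qed.

Lemma jump_support_sub : jump_support `<=` `[0, 2]%classic.
Proof.
move=> t /(_ 0%N Logic.I)[j /=]; rewrite expn0 ltnS leqn0 => /eqP ->.
by rewrite /jump_sum big_geq// add0r expr0 divr1.
Qed.

Lemma measurable_jump_support : measurable (jump_support : set (measurableTypeR R)).
Proof. exact: closed_measurable closed_jump_support. Qed.

Lemma jump_cover_measure n : (leb (jump_cover n) <= (2 / 4 ^+ n)%:E)%E.
Proof.
rewrite /jump_cover bigcup_mkord.
have := @Boole_inequality _ _ _ (@lebesgue_measure R)
  (fun j => `[jump_sum (j%:R / 2 ^+ n) n,
              jump_sum (j%:R / 2 ^+ n) n + 2 / 8 ^+ n]%classic) (2 ^ n).
move=> /(_ (fun j _ => measurable_itv _)) /le_trans; apply.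
rewrite (eq_bigr (fun=> (2 / 8 ^+ n)%:E)); last first.
  move=> j _; rewrite [LHS]lebesgue_measure_itv/= lte_fin ltrDl divr_gt0 ?exprn_gt0//.
  by rewrite -EFinD addrAC subrr add0r.
rewrite sumEFin big_const_ord iter_addr_0 lee_fin -[_ *+ (2 ^ n)]mulr_natr natrX.
rewrite (_ : 8 = 2 * 4 :> R) ?exprMn; last by ring.
have -> : 2 / (2 ^+ n * 4 ^+ n) * 2 ^+ n = 2 / 4 ^+ n :> R; last exact: lexx.
by field; rewrite !expf_neq0.
Qed.

Lemma jump_support_null : leb jump_support = 0%E.
Proof.
apply/eqP; rewrite -measure_le0; apply/lee_addgt0Pr => e e0; rewrite add0e.
pose n := (Num.truncn (2 / e)).+1.
apply: (@le_trans _ _ (leb (jump_cover n))).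
  apply: le_measure; rewrite ?inE; [exact: measurable_jump_support| |].
    exact: closed_measurable (@closed_jump_cover n).
  exact: bigcap_inf.
apply: le_trans (jump_cover_measure n) _; rewrite lee_fin.
rewrite ler_pdivrMr ?exprn_gt0// mulrC -ler_pdivrMr//.
apply: (@le_trans _ _ n%:R); first exact: ltW (truncnS_gt _).
by rewrite -natrX ler_nat ltnW// ltn_expl.
Qed.

Let segment_measurable : measurable (`[0, 1[%classic : set (measurableTypeR R)).
Proof. exact: measurable_itv. Qed.

Definition jump_curve (x : measurableTypeR R) : circle R := circle_expi (jump x).

Lemma measurable_jump_curve : measurable_fun setT jump_curve.
Proof.
apply: (measurableT_comp (@measurable_circle_expi R)).
exact: nondecreasing_measurable jump_nondecreasing.
Qed.

HB.instance Definition _ :=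
  isMeasurableFun.Build _ _ _ _ jump_curve measurable_jump_curve.

Let measurable_preimage (A : set (circle R)) : measurable A ->
  measurable (jump_curve @^-1` A `&` `[0, 1[%classic).
Proof.
move=> mA; apply: measurableI => //; rewrite -[X in measurable X]setTI.
exact: measurable_jump_curve.
Qed.

Definition jump_measure : set (circle R) -> \bar R :=
  pushforward (mrestr lebesgue_measure segment_measurable) jump_curve.

Let jump_measure0 : jump_measure set0 = 0%E.
Proof. exact: measure0. Qed.

Let jump_measure_ge0 A : (0 <= jump_measure A)%E.
Proof. exact: measure_ge0. Qed.

Let jump_measure_sigma_additive : semi_sigma_additive jump_measure.
Proof. exact: measure_semi_sigma_additive. Qed.

HB.instance Definition _ := isMeasure.Build _ _ _ jump_measure
  jump_measure0 jump_measure_ge0 jump_measure_sigma_additive.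

Let jump_measure_fin : fin_num_fun jump_measure.
Proof.
move=> A mA; rewrite ge0_fin_numE// /jump_measure/pushforward/mrestr.
apply: (@le_lt_trans _ _ (leb `[0, 1[%classic)).
  by apply: le_measure; rewrite ?inE//; exact: measurable_preimage.
by rewrite lebesgue_measure_itv/= lte01 ltry.
Qed.

HB.instance Definition _ := Measure_isFinite.Build _ _ _ jump_measure jump_measure_fin.

Lemma jump_itv (x : R) : 0 <= x < 1 -> 0 <= jump x <= 7^-1.
Proof.
move=> /andP[x0 x1]; rewrite (le_trans _ (jump_sum_le_jump x 0)); last first.
  by rewrite /jump_sum big_geq.
by have := @jump_small R x 0 x0; rewrite expr0 mul1r invr1 mul1r; apply.
Qed.

(** Both [jump] and [circle_expi] are injective where they are used, so a point
    has at most one parameter in [[0, 1[]. *)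
Lemma jump_measure_set1 z : jump_measure [set z] = 0%E.
Proof.
rewrite /jump_measure/pushforward/mrestr.
have [->|/set0P[x [/= xz]]] := eqVneq (jump_curve @^-1` [set z] `&` `[0, 1[) set0.
  exact: measure0.
rewrite in_itv/= => x01.
apply: (@subset_measure0 _ _ _ _ _ [set x]) => //; last exact: lebesgue_measure_set1.
  apply: measurable_preimage; apply: closed_circle_measurable.
  by apply: compact_closed; [exact: circle_hausdorff|exact: compact_set1].
move=> y [/= yz]; rewrite in_itv/= => y01.
have /andP[gx0 gx1] := jump_itv x01; have /andP[gy0 gy1] := jump_itv y01.
have p2 := pi_ge2 R.
have gE : jump y = jump x.
  apply: circle_expi_inj; last by rewrite -[LHS]/(jump_curve y) yz -xz.
    by rewrite gy0/=; lra.
  by rewrite gx0/=; lra.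
case/andP: x01 => x0 _; case/andP: y01 => y0 _.
apply/eqP; case: (ltgtP y x) => // /jump_increasing; rewrite gE ltxx.
  by move=> /(_ y0).
by move=> /(_ x0).
Qed.

(** The null set is the image of [jump_support]: every parameter is sent into it,
    and its angles in [[0, 2 pi[] are those of [jump_support] itself, because
    [jump_support] lies in [[0, 2]] and [2 <= pi]. *)
Lemma jump_measure_singular : mutually_singular jump_measure (circle_lebesgue R).
Proof.
have cK : compact jump_support.
  apply: subclosed_compact closed_jump_support (@segment_compact _ 0 2) _.
  exact: jump_support_sub.
have clK : closed (@circle_expi R @` jump_support).
  apply: compact_closed; first exact: circle_hausdorff.
  apply: continuous_compact cK; apply: continuous_subspaceT.
  exact: continuous_circle_expi.
exists (~` (@circle_expi R @` jump_support)); split.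
- by apply: measurableC; exact: closed_circle_measurable.
- rewrite -[LHS]/(leb (jump_curve @^-1` (~` (@circle_expi R @` jump_support))
                        `&` `[0, 1[%classic)).
  rewrite (_ : _ `&` _ = set0) ?measure0// -subset0 => x [/= + xI]; apply.
  by exists (jump x) => //; apply: jump_in_support; move: xI; rewrite in_itv.
rewrite setCK -[LHS]/(leb (@circle_expi R @^-1` (@circle_expi R @` jump_support)
  `&` `[0, 2 * pi[%classic)).
apply: (@subset_measure0 _ (measurableTypeR R) R leb _ jump_support);
  last exact: jump_support_null.
- apply: measurableI => //; rewrite -[X in measurable X]setTI.
  apply: measurable_circle_expi => //; exact: closed_circle_measurable.
- exact: measurable_jump_support.
move=> t [/= [s Ks st]]; rewrite in_itv/= => t2.
have /= := jump_support_sub Ks; rewrite in_itv/= => /andP[s0 s2].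
rewrite -(circle_expi_inj _ _ st)//.
by rewrite s0 (le_trans s2) ?pi_ge2.
Qed.

Lemma jump_measure_ge (A : set (circle R)) (a b : R) : measurable A ->
  0 <= a <= b -> b <= 1 -> (forall x, a <= x < b -> A (jump_curve x)) ->
  ((b - a)%:E <= jump_measure A)%E.
Proof.
move=> mA /andP[a0 ab] b1 abA.
have -> : (b - a)%:E = leb `[a, b[%classic.
  rewrite lebesgue_measure_itv/= lte_fin; case: ltgtP ab => // ->.
  by rewrite subrr.
apply: le_measure; rewrite ?inE//; first exact: measurable_preimage.
move=> x; rewrite /= in_itv/= => /[dup] /abA Ax /andP[ax xb]; split => //=.
by rewrite in_itv/= (le_trans a0)// (lt_le_trans xb).
Qed.

End jump_measure.

(** * Mass and oscillation at scale 16^-N *)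

Section scales.
Context (R : realType).

(** The sets [E] and [F] of the commutator bound.  The radii are squares of
    multiples of [4^-N]: [sqrt |z - 1|] is at most [4^-N / 2] on the first set and
    at least [3/4 * 4^-N] on the second. *)
Definition near_one N : set (circle R) := [set z | dist1 z <= 16 ^- N / 4].

Definition off_one N : set (circle R) :=
  [set z | 9 / 16 * 16 ^- N <= dist1 z <= 4 * 16 ^- N].

Lemma measurable_near_one N : measurable (near_one N).
Proof.
have md := continuous_circle_measurable (@continuous_dist1 R).
rewrite (_ : near_one N = setT `&` dist1 @^-1` `]-oo, 16 ^- N / 4]%classic).
  exact: md.
by rewrite setTI; apply/seteqP; split => z; rewrite /near_one/= in_itv.
Qed.

Lemma measurable_off_one N : measurable (off_one N).
Proof.
have md := continuous_circle_measurable (@continuous_dist1 R).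
rewrite (_ : off_one N = setT `&`
    dist1 @^-1` `[9 / 16 * 16 ^- N, 4 * 16 ^- N]%classic).
  exact: md.
by rewrite setTI; apply/seteqP; split => z; rewrite /off_one/= in_itv.
Qed.

(** The constant [7/4] is an upper bound of [sqrt 2] that cancels the [1/7] of
    [jump_small]. *)
Lemma dist1_jump_le (x c : R) : 0 <= jump x <= c ->
  dist1 (jump_curve x) <= 7 / 4 * c.
Proof.
move=> /andP[g0 gc]; have := dist1_expi_le g0.
have c0 := le_trans g0 gc; have d0 := Defs.normc_ge0 (circle_val (jump_curve x) - 1).
rewrite -[circle_expi _]/(jump_curve x) => d.
rewrite -(@ler_pXn2r _ 2)// ?nnegrE ?mulr_ge0// (le_trans d)//.
have := ler_pM g0 g0 gc gc; have := mulr_ge0 c0 c0; nra.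
Qed.

(** Parameters [x < 2^-N] land at angle at most [16^-N / 7]. *)
Lemma near_one_mass N : (((2 ^- N)%:E : \bar R) <= jump_measure (near_one N))%E.
Proof.
have p2 : (0 : R) < 2 ^+ N by rewrite exprn_gt0.
rewrite -[2 ^- N]subr0; apply: jump_measure_ge.
- exact: measurable_near_one.
- by rewrite lexx invr_ge0 ltW.
- by rewrite invf_le1// exprn_ege1// ler1n.
move=> x /andP[x0 xN]; rewrite /near_one/=.
have xn : 2 ^+ N * x < 1 by rewrite mulrC -ltr_pdivlMr// mul1r.
have gx := jump_small x0 xn.
have g0 : 0 <= jump x.
  by apply: le_trans (jump_sum_le_jump x 0); rewrite /jump_sum big_geq.
have := @dist1_jump_le x _ (introT andP (conj g0 gx)); lra.
Qed.

(** Parameters in [[2^-(N+1), 2^-N[] land at an angle between [16^-(N+1)] and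
    [16^-N / 7].  The successor keeps this interval inside [[0, 1[]. *)
Lemma off_one_mass N : (((2 ^- N.+1)%:E : \bar R) <= jump_measure (off_one N.+1))%E.
Proof.
have p2 : (0 : R) < 2 ^+ N.+1 by rewrite exprn_gt0.
have p16 : (0 : R) < 16 ^- N by rewrite invr_gt0 exprn_gt0.
have p161 : (16 : R) ^- N <= 1 by rewrite invf_le1 ?exprn_gt0// exprn_ege1// ler1n.
have p2V : (0 : R) < 2 ^- N.+1 by rewrite invr_gt0.
have e2 : (2 : R) ^- N = 2 * 2 ^- N.+1 by rewrite exprS; field; rewrite expf_neq0.
have e16 : (16 : R) ^- N = 16 * 16 ^- N.+1 by rewrite exprS; field; rewrite expf_neq0.
have -> : (2 : R) ^- N.+1 = 2 ^- N - 2 ^- N.+1 by rewrite e2; ring.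
apply: jump_measure_ge.
- exact: measurable_off_one.
- by rewrite e2; apply/andP; split; lra.
- by rewrite invf_le1 ?exprn_gt0// exprn_ege1// ler1n.
move=> x /andP[Nx xN]; rewrite /off_one/=.
have x0 : 0 <= x by apply: le_trans Nx; rewrite invr_ge0 ltW.
have xn : 2 ^+ N * x < 1 by rewrite mulrC -ltr_pdivlMr ?exprn_gt0// mul1r.
have xn1 : 1 <= 2 ^+ N.+1 * x by rewrite mulrC -ler_pdivrMr// mul1r.
have gx := jump_small x0 xn; have gx1 := jump_large xn1.
have g0 : 0 <= jump x by apply: le_trans gx1; rewrite invr_ge0 exprn_ge0.
have h1 := @dist1_jump_le x _ (introT andP (conj g0 gx)).
have h2 : 3 / 4 * jump x <= dist1 (jump_curve x).
  by apply: dist1_expi_ge; rewrite g0/=; lra.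
apply/andP; split; lra.
Qed.

End scales.
Arguments near_one : clear implicits.
Arguments off_one : clear implicits.

Theorem theorem3 (R : realType) :
  exists (phi : continuousType (circle R) R[i])
         (mu : {finite_measure set (circle R) -> \bar R}),
    [/\ mutually_singular mu (circle_lebesgue R),
        (forall z : circle R, mu [set z] = 0%E)
      & ~ exists2 A : {linear L2 mu -> L2 mu},
            L2_bounded A &
            forall h : L2 mu,
              A (circle_shift h) - circle_shift (A h) =
              L2_inner h (continuous_L2 mu phi) *: continuous_L2 mu (cst 1) -
              L2_inner h (continuous_L2 mu (cst 1)) *: continuous_L2 mu phi].
Proof.
exists (mkcts (@continuous_sqrt_dist1 R)), (@jump_measure R); split.
- exact: jump_measure_singular.
- exact: jump_measure_set1.
move=> [A [M AM] comm].
(* The bound at scale N reads s / 16 * s^2 <= 64 M^2 s^4 with s = 4^-N, that is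
   4^N <= 1024 M^2. *)
pose N := (Num.truncn (1024 * M ^+ 2)).+1.
have MN : 1024 * M ^+ 2 < 4 ^+ N.
  apply: (lt_trans (truncnS_gt _)).
  by rewrite -natrX ltr_nat ltn_expl.
pose s : R := 4 ^- N.
have s0 : 0 < s by rewrite invr_gt0 exprn_gt0.
have sq : (16 : R) ^- N = s ^+ 2.
  by rewrite /s exprVn -exprM mulnC exprM; congr (_ ^- N); ring.
have s2 : (2 : R) ^- N * 2 ^- N = s.
  by rewrite /s -invfM -exprMn; congr (_ ^- N); ring.
have mN := near_one_mass R N; have mF := off_one_mass R N.-1.
have cf : continuous (fun z : circle R => Num.sqrt (dist1 z)).
  by move=> z; apply: continuous_comp; [exact: continuous_dist1|exact: sqrt_continuous].
have E0 : (0 < jump_measure (near_one R N))%E.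
  by apply: (@lt_le_trans _ _ (2 ^- N)%:E) => //; rewrite lte_fin invr_gt0 exprn_gt0.
have := @commutator_bound R jump_measure (mkcts (@continuous_sqrt_dist1 R)) _
  A M (near_one R N) (off_one R N) 1 (s / 2) (3 / 4 * s) (4 * s ^+ 2)
  (@measurable_near_one R N) (@measurable_off_one R N) cf (fun=> erefl) AM comm.
have nE : forall z, near_one R N z -> Num.sqrt (dist1 z) <= s / 2.
  move=> z; rewrite /near_one/= sq => dz.
  rewrite -[s / 2]ger0_norm ?divr_ge0 ?(ltW s0)// -sqrtr_sqr ler_wsqrtr//.
  by apply: (le_trans dz); rewrite [leRHS](_ : _ = s ^+ 2 / 4) ?lexx//; field.
have nF : forall z, off_one R N z -> 3 / 4 * s <= Num.sqrt (dist1 z).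
  move=> z; rewrite /off_one/= sq => /andP[dz _].
  rewrite -[3 / 4 * s]ger0_norm ?mulr_ge0 ?(ltW s0)// -sqrtr_sqr ler_wsqrtr//.
  by apply: le_trans dz; rewrite [leLHS](_ : _ = 9 / 16 * s ^+ 2) ?lexx//; field.
have nEF : forall z, (near_one R N `|` off_one R N) z ->
    normc (circle_val z - 1) <= 4 * s ^+ 2.
  move=> z []; rewrite /near_one/off_one/= -/(dist1 z) sq; last by case/andP.
  by move=> /le_trans; apply; have := sqr_ge0 s; lra.
move=> /(_ _ nE nF nEF E0); have ss : s / 2 <= 3 / 4 * s by lra.
move=> /(_ ss).
set massE := fine _; set massF := fine _.
have hE : 2 ^- N <= massE.
  by rewrite -lee_fin fineK ?fin_num_measure//; exact: measurable_near_one.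
have hF : 2 ^- N <= massF.
  by rewrite -lee_fin fineK ?fin_num_measure//; exact: measurable_off_one.
have p2 : (0 : R) <= 2 ^- N by rewrite invr_ge0 exprn_ge0.
have hEF : s <= massE * massF by rewrite -s2 ler_pM.
have Ms : 1024 * M ^+ 2 * s < 1 by rewrite -ltr_pdivlMr// mul1r invrK.
move=> H.
have H1 : s ^+ 3 / 16 <= 64 * M ^+ 2 * s ^+ 4.
  apply: le_trans (_ : (3 / 4 * s - s / 2) ^+ 2 * (massE * massF) <= _).
    have -> : s ^+ 3 / 16 = (3 / 4 * s - s / 2) ^+ 2 * s by field.
    by rewrite ler_wpM2l// sqr_ge0.
  apply: (le_trans H); rewrite [leLHS](_ : _ = 64 * M ^+ 2 * s ^+ 4) ?lexx//.
  by ring.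
have s3 : 0 < s ^+ 3 by rewrite exprn_gt0.
have : s ^+ 3 <= s ^+ 3 * (1024 * M ^+ 2 * s).
  have -> : s ^+ 3 * (1024 * M ^+ 2 * s) = 16 * (64 * M ^+ 2 * s ^+ 4) by ring.
  lra.
by rewrite -[leLHS]mulr1 ler_pM2l// leNgt Ms.
Qed.
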